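(* Let $r\ge 1$ be an integer, let $k_{1},\dots,k_{r}\ge 1$ be integers, and let $n\ge 0$ be an integer. Then $$S_{1}^{(k_{1},k_{2},\dots,k_{r})}(n+r,r)=r!\binom{n+r}{n}\sum_{m=0}^{n}B_{m}^{(k_{1},k_{2},\dots,k_{r})}{n \brack m}.$$
   Context: For integers $k_1,\dots,k_r$ ($r\ge 1$), the multiple logarithm is $\mathrm{Li}_{k_{1},\dots,k_{r}}(z)=\sum_{0<m_{1}<m_{2}<\cdots<m_{r}}\frac{z^{m_{r}}}{m_{1}^{k_{1}}m_{2}^{k_{2}}\cdots m_{r}^{k_{r}}}$ for $|z|<1$ (the sum is over positive integers; it may equally be regarded as a formal power series in $z$, divisible by $z^r$). The multi-Stirling numbers of the first kind $S_{1}^{(k_{1},\dots,k_{r})}(n,r)$ are defined by $\mathrm{Li}_{k_{1},\dots,k_{r}}(t)=\sum_{n=r}^{\infty}S_{1}^{(k_{1},\dots,k_{r})}(n,r)\frac{t^{n}}{n!}$. The multi-Bernoulli numbers $B_{m}^{(k_{1},\dots,k_{r})}$ are defined by $\frac{\mathrm{Li}_{k_{1},\dots,k_{r}}(z)}{z^{r}}\Big|_{z=1-e^{-t}}=\sum_{m=0}^{\infty}B_{m}^{(k_{1},\dots,k_{r})}\frac{t^{m}}{m!}$. The unsigned Stirling number of the first kind ${n\brack m}$ is the number of permutations of a set with $n$ elements that are products of exactly $m$ disjoint cycles (so ${0\brack 0}=1$ and ${n\brack 0}=0$ for $n\ge 1$). *)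

(* Defs.v *)
From HB Require Import structures.
From mathcomp Require Import all_boot all_order all_algebra all_fingroup.

Set Implicit Arguments.
Unset Strict Implicit.
Unset Printing Implicit Defensive.

Import Order.TTheory GRing.Theory Num.Theory.
Local Open Scope ring_scope.

(* Formal power series over the rationals; [f n] is the coefficient of the
   n-th power of the variable. *)
Definition fps := nat -> rat.

Definition fps_one : fps := fun n => (n == 0%N)%:R.

Definition fps_mul (f g : fps) : fps :=
  fun n => \sum_(i < n.+1) f i * g (n - i)%N.

Definition fps_pow (f : fps) (j : nat) : fps := iter j (fps_mul f) fps_one.

(* Substitution of [g] for the variable of [f].  It is meaningful when
   [g 0 = 0]: then [g ^ j] has no term of degree < j, so only the powers
   [j <= n] contribute to the coefficient of degree [n]. *)
Definition fps_comp (f g : fps) : fps :=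
  fun n => \sum_(j < n.+1) f j * fps_pow g j n.

(* Quotient by the [r]-th power of the variable; it is exact when the first
   [r] coefficients of [f] vanish. *)
Definition fps_divX (r : nat) (f : fps) : fps := fun n => f (n + r)%N.

(* 1 - exp(-t) *)
Definition one_sub_exp_opp : fps :=
  fun n => (n == 0%N)%:R - (-1) ^+ n / n`!%:R.

(* Li_{k_1,...,k_r}(z): the coefficient of z^n collects the sequences
   0 < m_1 < ... < m_r with m_r = n.  All the m_i are then at most n, so the
   sum over r-tuples of 'I_n.+1 misses none of them. *)
Definition multi_log (r : nat) (k : 'I_r -> int) : fps :=
  fun n =>
    \sum_(m : r.-tuple 'I_n.+1 |
            path ltn 0%N (map val m) && (last 0%N (map val m) == n))
      (\prod_(i < r) (tnth m i)%:R ^ k i)^-1.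

(* S_1^{(k_1,...,k_r)}(n, r), where r is the length of k *)
Definition multi_stirling1 (r : nat) (k : 'I_r -> int) (n : nat) : rat :=
  n`!%:R * multi_log k n.

(* B_m^{(k_1,...,k_r)} *)
Definition multi_bernoulli (r : nat) (k : 'I_r -> int) (m : nat) : rat :=
  m`!%:R * fps_comp (fps_divX r (multi_log k)) one_sub_exp_opp m.

(* [porbits s] is the set of all cycles of [s], fixed points included. *)
Definition stirling1 (n m : nat) : nat :=
  #|[set s : 'S_n | #|porbits s| == m]|.

(* Main.v *)
Require Import Defs.
From HB Require Import structures.
From mathcomp Require Import all_boot all_order all_algebra all_fingroup.
From mathcomp Require Import ring.

(** The identity inverts the substitution that defines the multi-Bernoulli
    numbers.
    Let [f = Li / z ^ r], so that [sum_m B_m t ^ m / m! = f (1 - exp (-t))].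
    Putting [t = - log (1 - z)] and expanding [(- log (1 - z)) ^ m / m!] as the
    generating function of the Stirling numbers of the first kind recovers the
    coefficients of [f]: [n! f_n] is the sum of the [B_m stirling1 n m]; the
    factor [r! 'C(n + r, n) = (n + r)! / n!] accounts for the shift by [r].

    The inversion is done here without the logarithm.  By linearity in [f] it
    says that the functional sending [t ^ m] to [m! stirling1 n m] maps
    [(1 - exp (-t)) ^ j] to [n!] if [j = n] and to [0] if [j < n]
    ([sum_stirling1_pow_one_sub_exp_opp]).  By the binomial theorem the power is
    a combination of the exponentials [exp (- i t)], [i <= j]
    ([pow_one_sub_exp_oppE]), and the functional maps [exp (x t)] to
    [sum_m stirling1 n m x ^ m], which is the rising factorial
    [x (x + 1) ... (x + n - 1)] ([sum_stirling1_exp]).  At [x = - i] with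
    [i <= n] this vanishes unless [i = n].

    The rising factorial formula is proved on permutations, by counting cycles:
    a permutation of [n + 1] points is uniquely a permutation of [n] points,
    extended by a fixed point, composed with the transposition of this point and
    an arbitrary point. *)

Set Implicit Arguments.
Unset Strict Implicit.
Unset Printing Implicit Defensive.

Import Order.TTheory GRing.Theory Num.Theory.
Local Open Scope ring_scope.

(** * Cycle counts and rising factorials *)

Lemma lift_permX (n : nat) (i : 'I_n.+1) (s : 'S_n) (m : nat) :
  (lift_perm i i s ^+ m = lift_perm i i (s ^+ m))%g.
Proof.
by elim: m => [|m IHm]; rewrite ?lift_perm1 // !expgS IHm lift_permM.
Qed.

Lemma porbit_lift_perm_id (n : nat) (i : 'I_n.+1) (s : 'S_n) :
  porbit (lift_perm i i s) i = [set i].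
Proof.
apply/setP => y; rewrite inE; apply/porbitP/eqP => [[m ->]|->].
  by rewrite lift_permX lift_perm_id.
by exists 0%N; rewrite expg0 perm1.
Qed.

Lemma porbit_lift_perm_lift (n : nat) (i : 'I_n.+1) (s : 'S_n) (x : 'I_n) :
  porbit (lift_perm i i s) (lift i x) = lift i @: porbit s x.
Proof.
apply/setP => y; apply/porbitP/imsetP => [[m ->]|[z /porbitP[m ->] ->]].
  by rewrite lift_permX lift_perm_lift; exists ((s ^+ m)%g x) => //; apply/porbitP; exists m.
by exists m; rewrite lift_permX lift_perm_lift.
Qed.

Lemma card_porbits_lift_perm (n : nat) (i : 'I_n.+1) (s : 'S_n) :
  #|porbits (lift_perm i i s)| = #|porbits s|.+1.
Proof.
have -> : porbits (lift_perm i i s) =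
    [set i] |: [set lift i @: (A : {set 'I_n}) | A in porbits s].
  apply/setP => B; rewrite !inE; apply/imsetP/orP => [[y _ ->]|].
    case: (unliftP i y) => [x|] ->; last by left; rewrite porbit_lift_perm_id.
    by right; rewrite porbit_lift_perm_lift; apply/imset_f/imset_f.
  case=> [/eqP->|/imsetP[A /imsetP[x _ ->] ->]].
    by exists i => //; rewrite porbit_lift_perm_id.
  by exists (lift i x) => //; rewrite porbit_lift_perm_lift.
rewrite cardsU1 card_imset; last exact/imset_inj/lift_inj.
case: imsetP => // -[A _ /setP/(_ i)]; rewrite inE eqxx => /esym/imsetP[x _ eq_ix].
by have := neq_lift i x; rewrite -eq_ix eqxx.
Qed.

Definition insert_max (n : nat) (p : 'I_n.+1 * 'S_n) : 'S_n.+1 :=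
  (tperm p.1 ord_max * lift_perm ord_max ord_max p.2)%g.

(** The index is the point sent to [ord_max]; once it is known, the transposition
    cancels.  So [insert_max] is injective, and the cardinals agree. *)
Lemma insert_max_bij (n : nat) : bijective (@insert_max n).
Proof.
apply: inj_card_bij => [[i s] [j t] eq_st|]; last first.
  by rewrite card_prod card_ord !card_Sn factS.
have insert_i (a : 'I_n.+1) u : insert_max (a, u) a = ord_max.
  by rewrite permM tpermL lift_perm_id.
have eq_ij : i = j.
  by apply: (@perm_inj _ (insert_max (i, s))); rewrite insert_i eq_st insert_i.
subst j; congr (_, _); apply/permP => x; apply: (@lift_inj _ ord_max).
rewrite -!(lift_perm_lift ord_max ord_max).
by move/mulgI: eq_st => ->.
Qed.

(** Composing with a transposition of a fixed point and another point merges
    two cycles. *)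
Lemma card_porbits_insert_max (n : nat) (i : 'I_n.+1) (s : 'S_n) :
  #|porbits (insert_max (i, s))| = (#|porbits s| + (i == ord_max))%N.
Proof.
have := porbits_mul_tperm (lift_perm ord_max ord_max s) i ord_max.
rewrite porbit_lift_perm_id inE card_porbits_lift_perm /insert_max /=.
by case: eqP => _ /=; rewrite ?addn0 ?addn1 // addn2 => -[].
Qed.

Lemma sum_exp_card_porbits (R : comPzRingType) (n : nat) (x : R) :
  \sum_(s : 'S_n) x ^+ #|porbits s| = \prod_(i < n) (x + i%:R).
Proof.
elim: n => [|n IHn].
  rewrite big_ord0 (big_pred1 1%g) => [|s]; last first.
    by apply/esym/eqP/permP; case.
  rewrite (_ : porbits _ = set0) ?cards0 //.
  by apply/setP => B; rewrite inE; apply/imsetP; case; case.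
rewrite (reindex _ (onW_bij _ (insert_max_bij n))) big_ord_recr /= -IHn mulr_suml.
rewrite -(pair_bigA _ (fun i s => x ^+ #|porbits (insert_max (i, s))|)) exchange_big /=.
apply: eq_bigr => s _.
under eq_bigr => i _ do rewrite card_porbits_insert_max.
rewrite big_ord_recr /= eqxx addn1 exprSr mulrDr addrC; congr (_ + _).
under eq_bigr => i _ do rewrite -val_eqE /= ltn_eqF //= addn0.
by rewrite sumr_const card_ord mulr_natr.
Qed.

Lemma sum_stirling1_exp (R : comPzRingType) (n : nat) (x : R) :
  \sum_(m < n.+1) (stirling1 n m)%:R * x ^+ m = \prod_(i < n) (x + i%:R).
Proof.
have card_le (s : 'S_n) : (#|porbits s| < n.+1)%N.
  by rewrite ltnS -[leqRHS]card_ord leq_imset_card.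
rewrite -sum_exp_card_porbits.
rewrite (partition_big (fun s : 'S_n => Ordinal (card_le s)) xpredT) //=.
apply: eq_bigr => m _.
rewrite (eq_bigr (fun=> x ^+ m)) => [|s /eqP<- //].
rewrite sumr_const mulr_natl; congr (_ *+ _).
by rewrite /stirling1 cardsE; apply: eq_card.
Qed.

(** * Powers of 1 - exp(-t) *)

Lemma fps_pow_eq0 (g : fps) (j m : nat) :
  g 0%N = 0 -> (m < j)%N -> fps_pow g j m = 0.
Proof.
move=> g0; elim: j m => // j IHj m lt_mj; rewrite /fps_pow iterS /fps_mul.
apply: big1 => -[[|i] /= lt_im] _; first by rewrite g0 mul0r.
by rewrite [X in _ * X]IHj ?mulr0 // ltn_subLR // addSn ltnS (leq_trans (_ : m <= j)%N) ?leq_addl.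
Qed.

Lemma fact_fps_mul (f g : fps) (n : nat) :
  n`!%:R * fps_mul f g n =
  \sum_(i < n.+1) 'C(n, i)%:R * ((i`!%:R * f i) * ((n - i)`!%:R * g (n - i)%N)).
Proof.
rewrite mulr_sumr; apply: eq_bigr => i _.
have <- := @bin_fact n i (ltn_ord i).
by rewrite !natrM -mulrA mulrACA.
Qed.

Lemma fact_one_sub_exp_opp (n : nat) :
  n`!%:R * one_sub_exp_opp n = (n == 0%N)%:R - (-1) ^+ n.
Proof.
have n_neq0 : n`!%:R != 0 :> rat by rewrite pnatr_eq0 -lt0n fact_gt0.
by rewrite /one_sub_exp_opp mulrBr mulrCA divff // mulr1; case: n n_neq0 => //= n _; rewrite mulr0.
Qed.

Lemma sum_binS (R : pzRingType) (j : nat) (F : nat -> R) :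
  \sum_(i < j.+2) 'C(j.+1, i)%:R * F i =
  \sum_(i < j.+1) 'C(j, i)%:R * (F i + F i.+1).
Proof.
under [RHS]eq_bigr => i _ do rewrite mulrDr.
rewrite big_split /= big_ord_recl /= bin0 [in RHS]big_ord_recl /= bin0 -addrA.
congr (_ + _); under eq_bigr => i _ do rewrite binS natrD mulrDl.
by rewrite big_split /= big_ord_recr /= bin_small // mul0r addr0.
Qed.

Lemma pow_one_sub_exp_oppE (j m : nat) :
  m`!%:R * fps_pow one_sub_exp_opp j m =
  \sum_(i < j.+1) 'C(j, i)%:R * ((-1) ^+ i * (- i%:R) ^+ m).
Proof.
elim: j m => [|j IHj] m.
  rewrite big_ord1 bin0 mul1r expr0 mul1r oppr0 expr0n /fps_pow /= /fps_one.
  by case: m => [|m]; rewrite ?mulr1 ?mulr0.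
rewrite /fps_pow iterS fact_fps_mul.
under eq_bigr => i _ do rewrite fact_one_sub_exp_opp IHj mulrBl mulrBr.
rewrite sumrB [X in X - _]big_ord_recl /= bin0 subn0 !mul1r.
rewrite [X in _ + X - _]big1 ?addr0 => [|i _]; last by rewrite mul0r mulr0.
rewrite (sum_binS _ (fun i => (-1) ^+ i * (- i%:R) ^+ m)).
under [RHS]eq_bigr => i _ do rewrite mulrDr.
rewrite big_split /= -sumrN; congr (_ + _).
under [LHS]eq_bigr => i _ do rewrite !mulr_sumr -sumrN.
rewrite exchange_big /=; apply: eq_bigr => l _.
(* exp (- l t) exp (- t) = exp (- (l + 1) t), on coefficients *)
have -> : - (l.+1%:R : rat) = - l%:R + -1 by rewrite -natr1 opprD.
rewrite exprDn !mulr_sumr; apply: eq_bigr => i _.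
rewrite exprS; ring.
Qed.

(** * Inversion *)

Lemma prod_subn_natr (n : nat) : \prod_(i < n) (- n%:R + i%:R) = (-1) ^+ n * n`!%:R :> rat.
Proof.
rewrite -ffactnn ffact_prod natr_prod -[in (-1) ^+ n](card_ord n) -prodrN.
by apply: eq_bigr => i _; rewrite natrB 1?ltnW // opprB addrC.
Qed.

(** The rising factorial at [- i] contains the factor [- i + i] when [i < n],
    so only the exponential [exp (- n t)] can contribute, and it occurs in the
    [j]-th power only for [j = n]. *)
Lemma sum_stirling1_pow_one_sub_exp_opp (n j : nat) : (j <= n)%N ->
  \sum_(m < n.+1) (m`!%:R * fps_pow one_sub_exp_opp j m) * (stirling1 n m)%:R =
  (j == n)%:R * n`!%:R.
Proof.
move=> le_jn; under eq_bigr => m _ do rewrite pow_one_sub_exp_oppE mulr_suml.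
rewrite exchange_big /=.
under eq_bigr => i _.
  under eq_bigr => m _ do rewrite -!mulrA [X in _ * (_ * X)]mulrC mulrA.
  rewrite -mulr_sumr sum_stirling1_exp; over.
have vanish (i : nat) : (i < n)%N -> \prod_(l < n) (- i%:R + l%:R) = 0 :> rat.
  move=> lt_in; rewrite (bigD1 (Ordinal lt_in)) //= addrC subrr mul0r //.
rewrite big_ord_recr /= big1 ?add0r => [|i _]; last first.
  by rewrite vanish ?mulr0 // (leq_trans (ltn_ord i)).
have [->|ne_jn] := eqVneq j n; last by rewrite vanish ?mulr0 ?mul0r // ltn_neqAle ne_jn.
by rewrite prod_subn_natr binn !mul1r mulrA -exprMn mulrNN mulr1 expr1n mul1r.
Qed.

Lemma fps_comp_one_sub_exp_opp_inv (f : fps) (n : nat) :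
  \sum_(m < n.+1) m`!%:R * fps_comp f one_sub_exp_opp m * (stirling1 n m)%:R =
  n`!%:R * f n.
Proof.
have g0 : one_sub_exp_opp 0 = 0 by rewrite /one_sub_exp_opp expr0 divr1 subrr.
(* A common range for [j] lets the two sums be exchanged. *)
have compE (m : 'I_n.+1) : fps_comp f one_sub_exp_opp m =
    \sum_(j < n.+1) f j * fps_pow one_sub_exp_opp j m.
  rewrite /fps_comp (big_ord_widen _ (fun j => f j * fps_pow _ j m) (ltn_ord m)).
  rewrite big_mkcond; apply: eq_bigr => j _.
  by case: ltnP => // lt_mj; rewrite fps_pow_eq0 ?mulr0.
under eq_bigr => m _ do rewrite compE mulr_sumr mulr_suml.
rewrite exchange_big /= big_ord_recr /= big1 ?add0r => [|j _].
  under eq_bigr => m _ do rewrite mulrCA -mulrA.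
  by rewrite -mulr_sumr sum_stirling1_pow_one_sub_exp_opp // eqxx mul1r mulrC.
under eq_bigr => m _ do rewrite mulrCA -mulrA.
by rewrite -mulr_sumr sum_stirling1_pow_one_sub_exp_opp 1?ltnW // ltn_eqF ?mul0r ?mulr0.
Qed.

Theorem theorem4 (r : nat) (k : 'I_r -> int) (n : nat)
    (hr : (1 <= r)%N) (hk : forall i : 'I_r, 1 <= k i) :
  multi_stirling1 k (n + r) =
  r`!%:R * 'C(n + r, n)%:R *
    \sum_(0 <= m < n.+1) multi_bernoulli k m * (stirling1 n m)%:R.
Proof.
rewrite big_mkord /multi_bernoulli fps_comp_one_sub_exp_opp_inv.
rewrite /multi_stirling1 /fps_divX mulrA; congr (_ * _).
rewrite -!natrM -(bin_fact (leq_addr r n)) addKn; congr (_%:R).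
by rewrite [(n`! * _)%N]mulnC mulnCA mulnA.
Qed.
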